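(* Let $0<\alpha<1$, $1<\beta\le 2$, $K_\alpha\ge 0$, $K_\beta>0$, $L>0$, $T>0$. The Crank–Nicolson difference scheme $$(I+D)U^n=(I-D)U^{n-1},\qquad n=1,\ldots,N,$$ is unconditionally stable. That is, for all integers $m\ge2$ and $N\ge1$, with $h=L/m$ and $\tau=T/N$ (no relation between $\tau$ and $h$ being required), every sequence of vectors $\mathscr{E}^0,\mathscr{E}^1,\ldots,\mathscr{E}^N\in\mathbb{R}^{m-1}$ satisfying the error equation $(I+D)\mathscr{E}^n=(I-D)\mathscr{E}^{n-1}$ for $n=1,\ldots,N$ satisfies $$\|\mathscr{E}^n\|\le\|\mathscr{E}^0\|,\qquad n=1,\ldots,N,$$ where $\|\cdot\|$ is the Euclidean norm.
   Context: The scheme discretizes the Riesz space fractional advection-dispersion equation $\frac{\partial u}{\partial t}=K_\alpha\frac{\partial^\alpha u}{\partial|x|^\alpha}+K_\beta\frac{\partial^\beta u}{\partial|x|^\beta}$ on $0<x<L$, $0<t\le T$, with zero Dirichlet boundary conditions; $U^n=[u_1^n,\ldots,u_{m-1}^n]^T$ collects the approximations $u_i^n$ of $u(ih,n\tau)$. The matrix $D$ is the $(m-1)\times(m-1)$ matrix $D=\mu_\alpha(A+A^T)+\mu_\beta(B+B^T)$ defined as follows. For real $\gamma>0$ let $g_0^{(\gamma)}=1$, $g_k^{(\gamma)}=\left(1-\frac{\gamma+1}{k}\right)g_{k-1}^{(\gamma)}$ for $k\ge1$ (so $g_k^{(\gamma)}=(-1)^k\binom{\gamma}{k}$), and let $w_0^{(\gamma)}=\frac{\gamma}{2}g_0^{(\gamma)}$,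 $w_k^{(\gamma)}=\frac{\gamma}{2}g_k^{(\gamma)}+\frac{2-\gamma}{2}g_{k-1}^{(\gamma)}$ for $k\ge1$. The Toeplitz matrices $A$ and $B$ have entries $A_{ij}=w_{i-j+1}^{(\alpha)}$ and $B_{ij}=w_{i-j+1}^{(\beta)}$ if $j\le i+1$, and $A_{ij}=B_{ij}=0$ if $j>i+1$. With $c_\alpha=\frac{1}{2\cos(\pi\alpha/2)}$ and $c_\beta=\frac{1}{2\cos(\pi\beta/2)}$, put $\mu_\alpha=\frac{\tau K_\alpha c_\alpha}{2h^\alpha}$ and $\mu_\beta=\frac{\tau K_\beta c_\beta}{2h^\beta}$. $I$ is the identity matrix of order $m-1$. *)

(* Defs.v *)
From mathcomp Require Import all_boot all_order all_algebra.
From mathcomp Require Import reals exp trigo.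

Set Implicit Arguments.
Unset Strict Implicit.
Unset Printing Implicit Defensive.

Import Order.TTheory GRing.Theory Num.Theory.
Local Open Scope ring_scope.

(* The norm `|_| that the library puts on matrices is the sup norm. *)
Definition l2norm (R : realType) (p : nat) (v : 'cV[R]_p) : R :=
  Num.sqrt (\sum_i v i 0 ^+ 2).

(* g_k = (-1)^k binom(gamma, k). *)
Fixpoint grunwald (R : realType) (gamma : R) (k : nat) : R :=
  if k is k'.+1 then (1 - (gamma + 1) / k%:R) * grunwald gamma k' else 1.

(* Weights of the weighted and shifted Grunwald difference operator. *)
Definition wsgd (R : realType) (gamma : R) (k : nat) : R :=
  if k is k'.+1 then
    gamma / 2 * grunwald gamma k + (2 - gamma) / 2 * grunwald gamma k'
  else gamma / 2 * grunwald gamma 0.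

(* The entries depend only on i - j, so numbering rows and columns from 0
   instead of 1 is harmless; the guard makes the subtraction i.+1 - j exact. *)
Definition wsgd_mx (R : realType) (p : nat) (gamma : R) : 'M[R]_p :=
  \matrix_(i, j) if (j <= i.+1)%N then wsgd gamma (i.+1 - j) else 0.

Definition riesz_coef (R : realType) (gamma : R) : R :=
  1 / (2 * cos (pi * gamma / 2)).

Definition riesz_mu (R : realType) (tau h K gamma : R) : R :=
  tau * K * riesz_coef gamma / (2 * h `^ gamma).

Definition riesz_mx (R : realType) (p : nat)
    (tau h Ka Kb alpha beta : R) : 'M[R]_p :=
  riesz_mu tau h Ka alpha *: (wsgd_mx p alpha + (wsgd_mx p alpha)^T)
  + riesz_mu tau h Kb beta *: (wsgd_mx p beta + (wsgd_mx p beta)^T).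

Definition crank_nicolson_step (R : realType) (p : nat) (D : 'M[R]_p)
    (u v : 'cV[R]_p) : Prop :=
  (1%:M + D) *m v = (1%:M - D) *m u.

(* Main.v *)
Require Import Defs.
From mathcomp Require Import all_boot all_order all_algebra.
From mathcomp Require Import reals exp trigo.
From mathcomp Require Import zify ring lra.

Import Order.TTheory GRing.Theory Num.Theory.
Local Open Scope ring_scope.

(** Adding and subtracting the two time levels turns the scheme into
    [v - u = - D (v + u)], so [|v|^2 - |u|^2 = - <D (v + u), v + u>] and the
    norm cannot grow as soon as the quadratic form of [D] is nonnegative.  This
    holds for every size of the mesh, whence unconditional stability.

    Only the symmetric part of a matrix enters its quadratic form, so the single
    superdiagonal [w_0] of the matrix [A] may be moved to the subdiagonal.  This
    leaves a lower triangular Toeplitz matrix with weights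
    [w_1, w_0 + w_2, w_3, w_4, ...].  Up to a sign, all of them but the first
    are nonpositive and all their partial sums are nonnegative, so that the
    triangular matrix is diagonally dominant by rows and by columns
    ([quad_form_ge0_of_dominant]).  Merging [w_0] with [w_2] is what makes the
    signs uniform: on their own these two weights have opposite signs when
    [alpha < 1].

    Signs and partial sums both come from one fact: the partial sums of the
    coefficients of [(1 - z)^gamma] are the coefficients of
    [(1 - z)^(gamma - 1)] (division by [1 - z]), whose signs are visible from
    their product form.  For [0 < gamma < 1] the first weight is positive, for
    [1 < gamma <= 2] it is negative; the factor [1 / (2 cos (pi gamma / 2))]
    changes sign at [gamma = 1] as well, so both terms of [D] contribute a
    nonnegative form. *)

(** * Quadratic forms and diagonal dominance *)

Definition quad_form (R : realType) (p : nat) (M : 'M[R]_p) (x : 'cV[R]_p) : R :=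
  \sum_i \sum_j M i j * (x i 0 * x j 0).

Lemma quad_formD (R : realType) (p : nat) (M M' : 'M[R]_p) (x : 'cV[R]_p) :
  quad_form R p (M + M') x = quad_form R p M x + quad_form R p M' x.
Proof.
rewrite /quad_form -big_split; apply: eq_bigr => i _.
by rewrite -big_split /=; apply: eq_bigr => j _; rewrite mxE mulrDl.
Qed.

Lemma quad_formZ (R : realType) (p : nat) (a : R) (M : 'M[R]_p) (x : 'cV[R]_p) :
  quad_form R p (a *: M) x = a * quad_form R p M x.
Proof.
rewrite /quad_form mulr_sumr; apply: eq_bigr => i _.
by rewrite mulr_sumr; apply: eq_bigr => j _; rewrite mxE -mulrA.
Qed.

Lemma quad_form_tr (R : realType) (p : nat) (M : 'M[R]_p) (x : 'cV[R]_p) :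
  quad_form R p M^T x = quad_form R p M x.
Proof.
rewrite /quad_form exchange_big; apply: eq_bigr => i _; apply: eq_bigr => j _.
by rewrite mxE [x j 0 * _]mulrC.
Qed.

(** Off the diagonal [M i j <= 0] and [x_i x_j <= (x_i^2 + x_j^2) / 2]; summing
    the resulting lower bounds leaves the row and column sums as the
    coefficients of the squares. *)
Lemma quad_form_ge0_of_dominant (R : realType) (p : nat) (M : 'M[R]_p)
    (x : 'cV[R]_p) :
  (forall i j, i != j -> M i j <= 0) ->
  (forall i, 0 <= \sum_j M i j) -> (forall j, 0 <= \sum_i M i j) ->
  0 <= quad_form R p M x.
Proof.
move=> offdiag_le0 row_ge0 col_ge0.
apply: (@le_trans _ _
  (\sum_i \sum_j M i j * (x i 0 ^+ 2 / 2 + x j 0 ^+ 2 / 2))).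
  under eq_bigr => i _ do (under eq_bigr => j _ do rewrite mulrDr;
    rewrite big_split -mulr_suml /=).
  rewrite big_split addr_ge0 //=.
    by apply: sumr_ge0 => i _; rewrite mulr_ge0 // divr_ge0 ?sqr_ge0.
  rewrite exchange_big; apply: sumr_ge0 => j _.
  by rewrite -mulr_suml mulr_ge0 // divr_ge0 ?sqr_ge0.
apply: ler_sum => i _; apply: ler_sum => j _.
have [<-|neq_ij] := eqVneq i j; first by rewrite -expr2 -splitr.
apply: ler_wnM2l; first exact: offdiag_le0.
have := sqr_ge0 (x i 0 - x j 0); lra.
Qed.

(** * Lower triangular Toeplitz matrices *)

Definition lower_toeplitz_mx (R : realType) (p : nat) (t : nat -> R) : 'M[R]_p :=
  \matrix_(i, j) if (j <= i)%N then t (i - j)%N else 0.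

Lemma lower_toeplitz_row_sum (R : realType) (p : nat) (t : nat -> R) (i : 'I_p) :
  \sum_j lower_toeplitz_mx R p t i j = \sum_(k < i.+1) t k.
Proof.
under eq_bigr => j _ do rewrite mxE.
rewrite -big_mkcond /= -(big_ord_widen p (fun j => t (i - j)%N) (ltn_ord i)).
rewrite (reindex_inj rev_ord_inj) /=.
by apply: eq_bigr => k _; congr t; have := ltn_ord k; lia.
Qed.

Lemma lower_toeplitz_col_sum (R : realType) (p : nat) (t : nat -> R) (j : 'I_p) :
  \sum_i lower_toeplitz_mx R p t i j = \sum_(k < p - j) t k.
Proof.
under eq_bigr => i _ do rewrite mxE.
rewrite -big_mkcond /=.
rewrite -(big_geq_mkord j p xpredT (fun i => t (i - j)%N)).
rewrite -{1}[j : nat]add0n big_addn big_mkord.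
by apply: eq_bigr => k _; rewrite addnK.
Qed.

Lemma lower_toeplitz_form_ge0 (R : realType) (p : nat) (t : nat -> R)
    (x : 'cV[R]_p) :
  (forall k, t k.+1 <= 0) -> (forall n, 0 <= \sum_(k < n.+1) t k) ->
  0 <= quad_form R p (lower_toeplitz_mx R p t) x.
Proof.
move=> t_le0 psum_ge0; apply: quad_form_ge0_of_dominant => [i j neq_ij|i|j].
- rewrite mxE; case: leqP => // le_ji.
  have lt_ji : (j < i)%N by rewrite ltn_neqAle le_ji andbT eq_sym.
  by rewrite -(subnSK lt_ji).
- by rewrite lower_toeplitz_row_sum.
- by rewrite lower_toeplitz_col_sum -(subnSK (ltn_ord j)).
Qed.

(** * Signs and partial sums of the weights *)

(** The absorption identity
    [(n + 1) binom(gamma, n + 1) = gamma binom(gamma - 1, n)], with the signs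
    [(-1)^k] included.  It reduces the signs of the coefficients for [gamma] to
    those for [gamma - 1]. *)
Lemma grunwald_absorption (R : realType) (gamma : R) (n : nat) :
  grunwald gamma n.+1 = - (gamma / n.+1%:R) * grunwald (gamma - 1) n.
Proof.
elim: n => [|n IHn]; first by rewrite /= !divr1; ring.
rewrite [LHS]/= -/(grunwald gamma n.+1) IHn [grunwald _ n.+1]/=.
rewrite -[n.+2%:R]natr1 -[n.+1%:R]natr1.
have n_ge0 : 0 <= n%:R :> R by exact: ler0n.
by field; apply/andP; split; lra.
Qed.

(** Partial sums of coefficients correspond to division of the generating
    function [(1 - z)^gamma] by [1 - z]. *)
Lemma grunwald_sum (R : realType) (gamma : R) (n : nat) :
  \sum_(k < n.+1) grunwald gamma k = grunwald (gamma - 1) n.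
Proof.
elim: n => [|n IHn]; first by rewrite big_ord1.
transitivity (grunwald (gamma - 1) n + grunwald gamma n.+1).
  by rewrite big_ord_recr IHn.
by rewrite (grunwald_absorption R gamma) [RHS]/=; ring.
Qed.

Lemma wsgd_sum (R : realType) (gamma : R) (n : nat) :
  \sum_(k < n.+2) wsgd gamma k =
    gamma / 2 * grunwald (gamma - 1) n.+1
    + (2 - gamma) / 2 * grunwald (gamma - 1) n.
Proof.
rewrite -!grunwald_sum !mulr_sumr big_ord_recl [in RHS]big_ord_recl -addrA.
by congr (_ + _); rewrite -big_split.
Qed.

Lemma grunwald_ge0 (R : realType) (gamma : R) (n : nat) :
  gamma <= 0 -> 0 <= grunwald gamma n.
Proof.
move=> gamma_le0; elim: n => [|n IHn] //=; apply: mulr_ge0 => //.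
by rewrite subr_ge0 ler_pdivrMr // mul1r -natr1 lerD2r (le_trans gamma_le0).
Qed.

(** For [0 <= gamma <= 1] the factor for [k = 1] is [- gamma] and the later
    ones are nonnegative. *)
Lemma grunwaldS_le0 (R : realType) (gamma : R) (n : nat) :
  0 <= gamma <= 1 -> grunwald gamma n.+1 <= 0.
Proof.
move=> /andP[gamma_ge0 gamma_le1].
elim: n => [|n IHn]; first by rewrite /= divr1; lra.
rewrite [grunwald _ n.+2]/= -/(grunwald gamma n.+1).
apply: mulr_ge0_le0 => //.
rewrite subr_ge0 ler_pdivrMr // mul1r -[n.+2%:R]natr1 lerD2r.
by rewrite (le_trans gamma_le1) // ler1n.
Qed.

(** [1%N] is the distance at which the superdiagonal weight [w_0] is merged. *)
Definition folded_wsgd (R : realType) (gamma : R) (k : nat) : R :=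
  wsgd gamma k.+1 + (if k == 1%N then wsgd gamma 0 else 0).

Lemma folded_wsgd0 (R : realType) (gamma : R) :
  folded_wsgd R gamma 0 = (1 - gamma) * (2 + gamma) / 2.
Proof. by rewrite /folded_wsgd /= divr1; field. Qed.

Lemma folded_wsgd1 (R : realType) (gamma : R) :
  folded_wsgd R gamma 1 = - (gamma * (1 - gamma) * (2 + gamma) / 4).
Proof. by rewrite /folded_wsgd /= divr1; field. Qed.

Lemma folded_wsgdSS (R : realType) (gamma : R) (k : nat) :
  folded_wsgd R gamma k.+2 =
    - (gamma / 2 * (gamma / k.+3%:R) * grunwald (gamma - 1) k.+2
       + (2 - gamma) / 2 * (gamma / k.+2%:R) * grunwald (gamma - 1) k.+1).
Proof.
rewrite /folded_wsgd addr0 [wsgd _ _]/wsgd !grunwald_absorption.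
ring.
Qed.

(** From distance [1] on, the term [w_0] skipped by the shift of the index has
    been restored, so this is a full partial sum [w_0 + ... + w_(n+2)]. *)
Lemma folded_wsgd_sum (R : realType) (gamma : R) (n : nat) :
  \sum_(k < n.+2) folded_wsgd R gamma k =
    gamma / 2 * grunwald (gamma - 1) n.+2
    + (2 - gamma) / 2 * grunwald (gamma - 1) n.+1.
Proof.
rewrite -wsgd_sum big_split /= [RHS]big_ord_recl addrC; congr (_ + _).
by rewrite 2!big_ord_recl /= big1 ?addr0 ?add0r.
Qed.

(** For [gamma < 1] the exponent in [(1 - z)^(gamma - 1)] is negative, hence all
    of its coefficients are nonnegative. *)
Lemma folded_wsgd_le0 (R : realType) (gamma : R) (k : nat) :
  0 < gamma < 1 -> folded_wsgd R gamma k.+1 <= 0.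
Proof.
move=> /andP[gamma_gt0 gamma_lt1].
case: k => [|k]; first by rewrite folded_wsgd1 oppr_le0 !mulr_ge0 //; lra.
rewrite folded_wsgdSS oppr_le0.
have G_ge0 n : 0 <= grunwald (gamma - 1) n by apply: grunwald_ge0; lra.
by apply: addr_ge0; apply: mulr_ge0 => //; apply: mulr_ge0;
  apply: divr_ge0 => //; lra.
Qed.

Lemma folded_wsgd_sum_ge0 (R : realType) (gamma : R) (n : nat) :
  0 < gamma < 1 -> 0 <= \sum_(k < n.+1) folded_wsgd R gamma k.
Proof.
move=> /andP[gamma_gt0 gamma_lt1]; case: n => [|n].
  by rewrite big_ord1 folded_wsgd0 !mulr_ge0 //; lra.
rewrite folded_wsgd_sum.
have G_ge0 k : 0 <= grunwald (gamma - 1) k by apply: grunwald_ge0; lra.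
by apply: addr_ge0; apply: mulr_ge0 => //; lra.
Qed.

(** For [1 < gamma <= 2] only the constant coefficient of
    [(1 - z)^(gamma - 1)] is positive, and it does not occur in the weights at
    distance [2] or more. *)
Lemma folded_wsgd_ge0 (R : realType) (gamma : R) (k : nat) :
  1 < gamma <= 2 -> 0 <= folded_wsgd R gamma k.+1.
Proof.
move=> /andP[gamma_gt1 gamma_le2].
case: k => [|k].
  by rewrite folded_wsgd1 -mulNr -mulNr -mulrN opprB !mulr_ge0 //; lra.
have G_le0 n : grunwald (gamma - 1) n.+1 <= 0.
  by apply: grunwaldS_le0; apply/andP; split; lra.
rewrite folded_wsgdSS oppr_ge0 -[leRHS]addr0.
by apply: lerD; apply: mulr_ge0_le0 => //; apply: mulr_ge0;
  apply: divr_ge0 => //; lra.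
Qed.

Lemma folded_wsgd_sum_le0 (R : realType) (gamma : R) (n : nat) :
  1 < gamma <= 2 -> \sum_(k < n.+1) folded_wsgd R gamma k <= 0.
Proof.
move=> /andP[gamma_gt1 gamma_le2]; case: n => [|n].
  rewrite big_ord1 folded_wsgd0 -oppr_ge0 -mulNr -mulNr opprB.
  by rewrite !mulr_ge0 //; lra.
have G_le0 k : grunwald (gamma - 1) k.+1 <= 0.
  by apply: grunwaldS_le0; apply/andP; split; lra.
rewrite folded_wsgd_sum -[leRHS]addr0.
by apply: lerD; apply: mulr_ge0_le0 => //; lra.
Qed.

(** * The discrete Riesz operator *)

(** Split off the superdiagonal part [Q]: transposing it moves [w_0] below the
    diagonal without changing the quadratic form. *)
Lemma wsgd_form_folded (R : realType) (p : nat) (gamma : R) (x : 'cV[R]_p) :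
  quad_form R p (wsgd_mx p gamma) x =
  quad_form R p (lower_toeplitz_mx R p (folded_wsgd R gamma)) x.
Proof.
pose P : 'M[R]_p := lower_toeplitz_mx R p (fun k => wsgd gamma k.+1).
pose Q : 'M[R]_p :=
  \matrix_(i, j) if (j == i.+1 :> nat) then wsgd gamma 0 else 0.
have -> : wsgd_mx p gamma = P + Q.
  apply/matrixP => i j; rewrite !mxE.
  case: (ltngtP j i.+1) => [lt_ji|lt_ij|eq_ij].
  - by rewrite addr0 -ltnS lt_ji subSn.
  - by rewrite addr0 leqNgt (ltn_trans _ lt_ij).
  - by rewrite eq_ij subnn ltnn add0r.
have -> : lower_toeplitz_mx R p (folded_wsgd R gamma) = P + Q^T.
  apply/matrixP => i j; rewrite !mxE /folded_wsgd.
  case: (leqP j i) => le_ji; last by rewrite ifF ?addr0 //; lia.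
  by congr (_ + _); have -> : (i - j == 1)%N = (i == j.+1 :> nat) by lia.
by rewrite !quad_formD quad_form_tr.
Qed.

(** The hypotheses are stated for the products with [mu], which makes them
    cover both ranges of [gamma]: the weights and [mu] change sign together. *)
Lemma wsgd_sym_form_ge0 (R : realType) (p : nat) (mu gamma : R) (x : 'cV[R]_p) :
  (forall k, mu * folded_wsgd R gamma k.+1 <= 0) ->
  (forall n, 0 <= mu * \sum_(k < n.+1) folded_wsgd R gamma k) ->
  0 <= quad_form R p (mu *: (wsgd_mx p gamma + (wsgd_mx p gamma)^T)) x.
Proof.
move=> le0 ge0.
rewrite scalerDr quad_formD !quad_formZ quad_form_tr wsgd_form_folded.
suff : 0 <= mu * quad_form R p (lower_toeplitz_mx R p (folded_wsgd R gamma)) x.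
  by move=> form_ge0; exact: addr_ge0.
rewrite -quad_formZ.
have -> : mu *: lower_toeplitz_mx R p (folded_wsgd R gamma) =
    lower_toeplitz_mx R p (fun k => mu * folded_wsgd R gamma k).
  by apply/matrixP => i j; rewrite !mxE; case: ifP => //; rewrite mulr0.
by apply: lower_toeplitz_form_ge0 => // n; rewrite -mulr_sumr.
Qed.

Lemma riesz_coef_ge0 (R : realType) (gamma : R) :
  0 < gamma < 1 -> 0 <= riesz_coef gamma.
Proof.
move=> /andP[gamma_gt0 gamma_lt1].
rewrite /riesz_coef divr_ge0 // mulr_ge0 // ltW //.
by apply: cos_gt0_pihalf; have := pi_gt0 R; nra.
Qed.

Lemma riesz_coef_le0 (R : realType) (gamma : R) :
  1 < gamma <= 2 -> riesz_coef gamma <= 0.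
Proof.
move=> /andP[gamma_gt1 gamma_le2].
rewrite /riesz_coef div1r invr_le0 mulr_ge0_le0 //.
(* A shift by [pi] brings the angle from [[pi / 2, pi]] back to [[- pi / 2, 0]]. *)
have -> : pi * gamma / 2 = (pi * gamma / 2 - pi) + pi :> R by rewrite subrK.
rewrite cosDpi oppr_le0.
by apply: cos_ge0_pihalf; have := pi_gt0 R; nra.
Qed.

Lemma riesz_muE (R : realType) (tau h K gamma : R) :
  riesz_mu tau h K gamma = tau * K / (2 * h `^ gamma) * riesz_coef gamma.
Proof. by rewrite /riesz_mu mulrAC. Qed.

Lemma riesz_form_ge0 (R : realType) (p : nat) (tau h Ka Kb alpha beta : R)
    (x : 'cV[R]_p) :
  0 <= tau -> 0 <= Ka -> 0 <= Kb -> 0 < alpha < 1 -> 1 < beta <= 2 ->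
  0 <= quad_form R p (riesz_mx p tau h Ka Kb alpha beta) x.
Proof.
move=> tau_ge0 Ka_ge0 Kb_ge0 alphaP betaP.
have scale_ge0 K gamma : 0 <= K -> 0 <= tau * K / (2 * h `^ gamma).
  by move=> K_ge0; rewrite divr_ge0 ?mulr_ge0 ?powR_ge0.
have mua_ge0 : 0 <= riesz_mu tau h Ka alpha.
  by rewrite riesz_muE mulr_ge0 ?scale_ge0 ?riesz_coef_ge0.
have mub_le0 : riesz_mu tau h Kb beta <= 0.
  by rewrite riesz_muE mulr_ge0_le0 ?scale_ge0 ?riesz_coef_le0.
rewrite quad_formD addr_ge0 //; apply: wsgd_sym_form_ge0 => n.
- by rewrite mulr_ge0_le0 ?folded_wsgd_le0.
- by rewrite mulr_ge0 ?folded_wsgd_sum_ge0.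
- by rewrite mulr_le0_ge0 ?folded_wsgd_ge0.
- by rewrite mulr_le0 ?folded_wsgd_sum_le0.
Qed.

(** * Stability *)

(** The identity [|u|^2 - |v|^2 = <D (v + u), v + u>] comes from
    [v - u = - D (v + u)] and the factorization [(u - v) (u + v)] of each
    difference of squares. *)
Lemma crank_nicolson_l2norm_le (R : realType) (p : nat) (D : 'M[R]_p)
    (u v : 'cV[R]_p) :
  (forall x, 0 <= quad_form R p D x) -> crank_nicolson_step D u v ->
  l2norm v <= l2norm u.
Proof.
move=> D_ge0; rewrite /crank_nicolson_step mulmxDl mulmxBl !mul1mx => step.
have diffE : v - u = - (D *m (v + u)).
  have vE : v = u - D *m u - D *m v by rewrite -step addrK.
  by rewrite mulmxDr opprD {1}vE addrAC [u - _]addrC addrK addrC.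
apply: ler_wsqrtr; rewrite -subr_ge0 -sumrB.
suff -> : \sum_i (u i 0 ^+ 2 - v i 0 ^+ 2) = quad_form R p D (v + u) by [].
apply: eq_bigr => i _.
have /matrixP/(_ i 0) := diffE; rewrite !mxE => diff_i.
rewrite -opprB subr_sqr diff_i mulNr opprK mulr_suml.
by apply: eq_bigr => j _; rewrite !mxE; ring.
Qed.

Theorem theorem2 (R : realType) (alpha beta Ka Kb L T : R)
    (halpha : 0 < alpha < 1) (hbeta : 1 < beta <= 2)
    (hKa : 0 <= Ka) (hKb : 0 < Kb) (hL : 0 < L) (hT : 0 < T)
    (m N : nat) (hm : (2 <= m)%N) (hN : (1 <= N)%N)
    (E : nat -> 'cV[R]_(m.-1))
    (hE : forall n : nat, (1 <= n <= N)%N ->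
      crank_nicolson_step
        (riesz_mx m.-1 (T / N%:R) (L / m%:R) Ka Kb alpha beta)
        (E n.-1) (E n)) :
  forall n : nat, (1 <= n <= N)%N -> l2norm (E n) <= l2norm (E 0%N).
Proof.
suff stable n : (n <= N)%N -> l2norm (E n) <= l2norm (E 0%N).
  by move=> n /andP[_]; exact: stable.
elim: n => [|n IHn] // lt_nN; apply: le_trans (IHn (ltnW lt_nN)).
apply: crank_nicolson_l2norm_le (hE n.+1 lt_nN) => x.
by apply: riesz_form_ge0 => //; [rewrite divr_ge0 // ltW|exact: ltW].
Qed.
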